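(* Let $p$ be an odd prime, $q=p^n$ with $n\in\mathbb N$, and let $\mathbb H^2=\{(\xi_1,\xi_2,\tau)\in\mathbb F_q^3:\tau=\xi_1^2-\xi_2^2\}$ be equipped with its normalized surface measure $\sigma$. Then $$\mathbf R^*_{\mathbb H^2}(2\to4)=(1+q^{-1}-q^{-2})^{1/4}.$$ In other words, the inequality $$\|(f\sigma)^\vee\|_{L^4(\mathbb F_q^3,\mathrm d\boldsymbol x)}^4\le\left(1+\frac1q-\frac1{q^2}\right)\|f\|_{L^2(\mathbb H^2,\mathrm d\sigma)}^4$$ holds for all $f:\mathbb H^2\to\mathbb C$ and is sharp (the constant is best possible), and equality holds if $f:\mathbb H^2\to\mathbb C$ is a constant function. Moreover, $f:\mathbb H^2\to\mathbb C$ is a maximizer of this inequality if and only if there exist $\lambda\in\mathbb C\setminus\{0\}$ and $a,b,c\in\mathbb F_q$ such that, for all $\eta,\zeta\in\mathbb F_q$, $$f(\eta(1,1)+\zeta(1,-1))=\lambda\exp\frac{2\pi i\,\mathrm{Tr}_n(a\eta+b\zeta+c\eta\zeta)}{p}.$$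
   Context: A function $f:\mathbb H^2\to\mathbb C$ is identified with its projection $f:\mathbb F_q^2\to\mathbb C$, $f(\xi_1,\xi_2)=f(\xi_1,\xi_2,\xi_1^2-\xi_2^2)$; every element of $\mathbb F_q^2$ is uniquely $\eta(1,1)+\zeta(1,-1)$ with $\eta,\zeta\in\mathbb F_q$. The trace map $\mathrm{Tr}_n:\mathbb F_q\to\mathbb F_p$ is $\mathrm{Tr}_n(x)=x+x^p+\dots+x^{p^{n-1}}$. $\mathbb F_q$ is the finite field with $q$ elements and $e:\mathbb F_q\to\mathbb S^1\subset\mathbb C$ is a fixed nontrivial additive character. For $\boldsymbol x,\boldsymbol\xi\in\mathbb F_q^d$, $\boldsymbol x\cdot\boldsymbol\xi=\sum_i x_i\xi_i$. For a nonempty set $S\subset\mathbb F_q^d$ with normalized surface measure $\sigma$ (uniform probability measure on $S$) and $f:S\to\mathbb C$, the extension operator is $(f\sigma)^\vee(\boldsymbol x)=\frac1{|S|}\sum_{\boldsymbol\xi\in S}f(\boldsymbol\xi)e(\boldsymbol x\cdot\boldsymbol\xi)$, $\boldsymbol x\in\mathbb F_q^d$. Norms: $\|f\|_{L^r(S,\mathrm d\sigma)}=\big(\frac1{|S|}\sum_{\boldsymbol\xi\in S}|f(\boldsymbol\xi)|^r\big)^{1/r}$ and $\|g\|_{L^r(\mathbb F_q^d,\mathrm d\boldsymbol x)}=\big(\sum_{\boldsymbol x\in\mathbb F_q^d}|g(\boldsymbol x)|^r\big)^{1/r}$. $\mathbf R^*_S(r\to s)$ denotes the best (smallest) constant for which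 $\|(f\sigma)^\vee\|_{L^s(\mathbb F_q^d,\mathrm d\boldsymbol x)}\le\mathbf R^*_S(r\to s)\|f\|_{L^r(S,\mathrm d\sigma)}$ holds for all $f:S\to\mathbb C$. A maximizer is a not identically zero function $f:S\to\mathbb C$ for which equality holds in the inequality with best constant. *)

(* Defs.v *)
From HB Require Import structures.
From mathcomp Require Import all_boot all_order all_algebra all_field.
From mathcomp Require Import complex.
From mathcomp Require Import all_classical all_reals all_analysis.

Set Implicit Arguments.
Unset Strict Implicit.
Unset Printing Implicit Defensive.

Import Order.TTheory GRing.Theory Num.Theory.
Local Open Scope ring_scope.
Local Open Scope complex_scope.

Definition expi (R : realType) (t : R) : R[i] := cos t +i* sin t.

Definition nontrivial_additive_character (R : realType) (F : finFieldType)
    (e : F -> R[i]) : Prop :=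
  [/\ forall x, Normc.normc (e x) = 1,
      forall x y, e (x + y) = e x * e y
    & exists x, e x != 1].

Definition dot (F : finFieldType) (d : nat) (x xi : 'rV[F]_d) : F :=
  \sum_(i < d) x 0 i * xi 0 i.

(* Functions on S are functions on the subtype of points of S. *)
Definition points (F : finFieldType) (d : nat) (S : {set 'rV[F]_d}) : finType :=
  {xi : 'rV[F]_d | xi \in S}.

Definition extension (R : realType) (F : finFieldType) (e : F -> R[i])
    (d : nat) (S : {set 'rV[F]_d}) (f : points S -> R[i]) (x : 'rV[F]_d) : R[i] :=
  #|S|%:R^-1 * \sum_(xi : points S) f xi * e (dot x (val xi)).

Definition norm_sigma (R : realType) (F : finFieldType) (d : nat)
    (S : {set 'rV[F]_d}) (r : R) (f : points S -> R[i]) : R :=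
  (#|S|%:R^-1 * \sum_(xi : points S) Normc.normc (f xi) `^ r) `^ r^-1.

Definition norm_dx (R : realType) (F : finFieldType) (d : nat)
    (r : R) (g : 'rV[F]_d -> R[i]) : R :=
  (\sum_(x : 'rV[F]_d) Normc.normc (g x) `^ r) `^ r^-1.

(* Pitfall: inf is 0 by convention on an empty or unbounded set; for nonempty S
   and r, s > 0 the set below is nonempty and bounded below by 0. *)
Definition best_constant (R : realType) (F : finFieldType) (e : F -> R[i])
    (d : nat) (S : {set 'rV[F]_d}) (r s : R) : R :=
  inf [set A : R | forall f : points S -> R[i],
         norm_dx s (extension e f) <= A * norm_sigma r f]%classic.

Definition maximizer (R : realType) (F : finFieldType) (e : F -> R[i])
    (d : nat) (S : {set 'rV[F]_d}) (r s : R) (f : points S -> R[i]) : Prop :=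
  (exists xi, f xi != 0) /\
  norm_dx s (extension e f) = best_constant e S r s * norm_sigma r f.

Definition H2 (F : finFieldType) : {set 'rV[F]_3} :=
  [set v : 'rV[F]_3 | v 0 2 == v 0 0 ^+ 2 - v 0 1 ^+ 2].

Lemma H2_point_subproof (F : finFieldType) (x y : F) :
  (\row_(i < 3) [:: x; y; x ^+ 2 - y ^+ 2]`_i) \in H2 F.
Proof. by rewrite inE !mxE. Qed.

Definition H2_point (F : finFieldType) (x y : F) : points (H2 F) :=
  exist (fun v => v \in H2 F) _ (H2_point_subproof x y).

(* The function on F^2 identified with f. *)
Definition H2_proj (R : realType) (F : finFieldType)
    (f : points (H2 F) -> R[i]) (x y : F) : R[i] :=
  f (H2_point x y).

Definition trace (F : finFieldType) (p n : nat) (x : F) : F :=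
  \sum_(i < n) x ^+ (p ^ i).

(* The representative in {0, ..., p-1} of an element t of the prime subfield
   of F; it is p (a junk value) when t lies outside the prime subfield. *)
Definition prime_rep (F : finFieldType) (p : nat) (t : F) : nat :=
  index t [seq k%:R | k <- iota 0 p].

Lemma trace_repP (F : finFieldType) (p n : nat) (x : F) :
  prime p -> #|F| = (p ^ n)%N ->
  (prime_rep p (trace p n x) < p)%N /\ (prime_rep p (trace p n x))%:R = trace p n x.
Proof.
move=> pp cF.
have ch : p \in [pchar F] := card_finPcharP cF pp.
have n0 : (0 < n)%N.
  by case: n cF => // cF; have := finNzRing_gt1 F; rewrite cF.
have trp : (trace p n x) ^+ p = trace p n x.
  rewrite /trace -(pFrobenius_autE ch) rmorph_sum /=.
  under eq_bigr => i _ do rewrite pFrobenius_autE -exprM -expnSr.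
  case: n n0 cF => // m _ cF.
  by rewrite big_ord_recr big_ord_recl /= -cF expf_card expn0 expr1 addrC.
set t := trace p n x in trp *.
suff tin : t \in [seq k%:R | k <- iota 0 p].
  have lt : (prime_rep p t < p)%N.
    by rewrite /prime_rep -[X in (_ < X)%N](size_iota 0 p) -(size_map (fun k => k%:R : F)) index_mem.
  split=> //.
  have := nth_index (0 : F) tin.
  by rewrite -/(prime_rep p t) (nth_map 0%N) ?size_iota // nth_iota.
pose P : {poly F} := 'X^p - 'X.
have p1 := prime_gt1 pp.
have sP : size P = p.+1.
  by rewrite size_polyDl size_polyXn // size_polyN size_polyX ltnS.
have P0 : P != 0 by rewrite -size_poly_eq0 sP.
have un : uniq [seq (k%:R : F) | k <- iota 0 p].
  rewrite map_inj_in_uniq ?iota_uniq // => i j.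
  rewrite !mem_iota /= add0n => ip jp.
  wlog ij : i j ip jp / (i <= j)%N.
    by move=> h; case: (leqP i j) => [/h|/ltnW /h h' /esym /h' ->]; auto.
  move=> /esym /eqP; rewrite -subr_eq0 -natrB // -(dvdn_pcharf ch) => d.
  apply/eqP; rewrite eqn_leq ij /= -subn_eq0 -leqn0 leqNgt; apply/negP.
  by move=> /dvdn_leq /(_ d); rewrite leqNgt (leq_ltn_trans (leq_subr _ _) jp).
apply: contraT => tn.
have := @max_poly_roots F P (t :: [seq k%:R | k <- iota 0 p]) P0.
rewrite /= tn un size_map size_iota sP ltnn; apply=> //.
rewrite /root !hornerE trp subrr eqxx /=.
apply/allP => _ /mapP[k _ ->].
by rewrite /root !hornerE -(pFrobenius_autE ch) pFrobenius_aut_nat subrr.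
Qed.

(* Main.v *)
(** In the null coordinates xi = eta (1, 1) + zeta (1, -1) the surface becomes
    tau = 4 eta zeta, and the fourth power of the L^4 norm of the extension
    counts, with weights f f (f f)^*, the quadruples w + h, w + u, w, w + h + u
    for which h and u are orthogonal for the polar form h1 u2 + h2 u1.
    Bounding each product by pairing opposite sides of the rectangle (AM-GM),
    and counting the q vectors u orthogonal to a given h <> 0, yields
    (q + 1) M^2 - q S with M the sum of |f|^2 and S that of |f|^4;
    Cauchy-Schwarz M^2 <= q^2 S on the q^2 points gives the sharp constant.
    Equality forces |f| to be constant and
    f (w + h) f (w + u) = f w f (w + h + u) on all rectangles.  On the axes such
    an f is a character; after division by these, f is a bicharacter phi with
    phi (s, k t) = phi (k s, t), that is, a character of c eta zeta. *)

Require Import Defs.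
From mathcomp Require Import all_boot all_order all_algebra all_field.
From mathcomp Require Import complex.
From mathcomp Require Import all_classical all_reals all_analysis.
From mathcomp Require Import ring lra.

Set Implicit Arguments.
Unset Strict Implicit.
Unset Printing Implicit Defensive.

Import Order.TTheory GRing.Theory Num.Theory.
Local Open Scope ring_scope.
Local Open Scope complex_scope.

(** * Rectangles in null coordinates and the energy bound *)

Definition orth (F : finFieldType) (h u : F * F) : bool :=
  h.1 * u.2 + h.2 * u.1 == 0.

(** The sides at the vertex [w] are [h] and [u], degenerate rectangles included. The sum has no
    evident sign; nonnegativity comes later, from the fourth moment. *)
Definition energy (C : numClosedFieldType) (F : finFieldType)
    (g : F * F -> C) : C :=
  \sum_(w : F * F) \sum_(h : F * F) \sum_(u : F * F | orth h u)
    g (w + h) * g (w + u) * (g w * g (w + h + u))^*%R.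

Definition sqmass (C : numClosedFieldType) (F : finFieldType)
    (g : F * F -> C) : C :=
  \sum_(w : F * F) `|g w| ^+ 2.

Definition qmass (C : numClosedFieldType) (F : finFieldType)
    (g : F * F -> C) : C :=
  \sum_(w : F * F) `|g w| ^+ 4.

Lemma card_field_gt0 (F : finFieldType) : (0 < #|F|)%N.
Proof. by apply/card_gt0P; exists 0. Qed.

Lemma natr_card_neq0 (C : numDomainType) (F : finFieldType) : #|F|%:R != 0 :> C.
Proof. by rewrite pnatr_eq0 -lt0n card_field_gt0. Qed.

(** The complement of [h] is a line, parametrised by one coordinate of [u]: the second if [h1]
    vanishes, the first otherwise. *)
Lemma card_orth (F : finFieldType) (h : F * F) :
  h != 0 -> #|[pred u | orth h u]| = #|F|.
Proof.
case: h => h1 h2 h0.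
have [h10|h10] := eqVneq h1 0.
  have h20 : h2 != 0 by apply: contra h0 => /eqP ->; rewrite h10.
  rewrite -(fintype.card_image (f := fun x : F => (0 : F, x))).
    2: by move=> x y [].
  apply: eq_card => -[u1 u2]; rewrite !inE /orth /= h10 mul0r add0r.
  rewrite mulf_eq0 (negPf h20) /=.
  apply/eqP/fintype.imageP => [->|[x _ [-> _]] //]; by exists u2.
rewrite -(fintype.card_image (f := fun x : F => (x, - (h2 * x / h1)))).
  2: by move=> x y [].
apply: eq_card => -[u1 u2]; rewrite !inE /orth /=.
apply/eqP/fintype.imageP => [E|[x _ [-> ->]]]; last by field.
exists u1 => //; congr pair; apply: (mulfI h10).
rewrite mulrN mulrCA divff // mulr1; apply/eqP; rewrite -addr_eq0; exact/eqP.
Qed.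

Lemma sum_shift (V : nmodType) (F : finFieldType) (f : F * F -> V) (u : F * F) :
  \sum_(w : F * F) f (w + u) = \sum_(w : F * F) f w.
Proof. by rewrite [RHS](reindex_inj (addIr u)). Qed.

(* The case h = 0 is separate because averaging the two side products would
   bring in |g w|^4 for every u, which is too large. *)
Definition side_bound (C : numClosedFieldType) (F : finFieldType)
    (g : F * F -> C) (w h u : F * F) : C :=
  if h == 0 then (`|g w| * `|g (w + u)|) ^+ 2
  else ((`|g w| * `|g (w + h)|) ^+ 2
        + (`|g (w + u)| * `|g (w + u + h)|) ^+ 2) / 2.

(** For [h != 0] this is 2xy <= x^2 + y^2 with x, y the products over two opposite sides; for
    [h = 0] the vertices coincide in pairs and equality holds. *)
Lemma side_boundP (C : numClosedFieldType) (F : finFieldType)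
    (g : F * F -> C) (w h u : F * F) :
  `|g (w + h) * g (w + u) * (g w * g (w + h + u))^*%R| <= side_bound g w h u.
Proof.
rewrite /side_bound !normrM norm_conjC !normrM.
case: eqVneq => [->|h0].
  rewrite !addr0 le_eqVlt; apply/orP; left; apply/eqP; ring.
rewrite [w + h + u]addrAC ler_pdivlMr ?ltr0n //.
set a := `|g w|; set b := `|g (w + h)|; set c := `|g (w + u)|.
set d := `|g (w + u + h)|; rewrite -subr_ge0.
have -> : (a * b) ^+ 2 + (c * d) ^+ 2 - b * c * (a * d) * 2
   = (a * b - c * d) ^+ 2 by ring.
by rewrite real_exprn_even_ge0 // realB ?realM ?normr_real.
Qed.

Lemma sum_pair_shift (C : numClosedFieldType) (F : finFieldType)
    (f : F * F -> C) :
  \sum_(h : F * F) \sum_(w : F * F) f w * f (w + h) =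
  (\sum_(w : F * F) f w) ^+ 2.
Proof.
rewrite exchange_big /= expr2 big_distrl /=; apply: eq_bigr => w _.
rewrite -big_distrr /=; congr (_ * _).
by rewrite -[RHS](sum_shift f w); apply: eq_bigr => h _; rewrite addrC.
Qed.

(** The term [h = 0] contributes [sqmass g ^+ 2], every [u] being orthogonal to it. For any other
    [h], translation by [u] makes both halves of the bound equal, and the q admissible [u] give q
    times the autocorrelation of [|g|^2] at [h]; these autocorrelations total
    [sqmass g ^+ 2 - qmass g]. *)
Lemma sum_side_bound (C : numClosedFieldType) (F : finFieldType)
    (g : F * F -> C) :
  \sum_(w : F * F) \sum_(h : F * F) \sum_(u : F * F | orth h u)
    side_bound g w h u =
  (#|F|%:R + 1) * sqmass g ^+ 2 - #|F|%:R * qmass g.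
Proof.
rewrite exchange_big /= (bigD1 (0 : F * F)) //=.
pose f (w : F * F) : C := `|g w| ^+ 2.
have sq4 : qmass g = \sum_(w : F * F) f w * f (w + 0).
  by apply: eq_bigr => w _; rewrite addr0 /f; ring.
have -> : \sum_(w : F * F) \sum_(u : F * F | orth 0 u) side_bound g w 0 u =
    sqmass g ^+ 2.
  rewrite -(sum_pair_shift f) exchange_big /=.
  apply: eq_big => [u|u _]; first by rewrite /orth !mul0r addr0 eqxx.
  by apply: eq_bigr => w _; rewrite /side_bound eqxx exprMn.
have -> : \sum_(h : F * F | h != 0) \sum_(w : F * F)
      \sum_(u : F * F | orth h u) side_bound g w h u =
    #|F|%:R * \sum_(h : F * F | h != 0) \sum_(w : F * F) f w * f (w + h).
  rewrite big_distrr /=; apply: eq_bigr => h h0.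
  rewrite exchange_big /= -(card_orth h0) -sum1_card natr_sum big_distrl /=.
  apply: eq_bigr => u _; rewrite mul1r.
  under eq_bigr => w _ do rewrite /side_bound (negPf h0) !exprMn mulrDl.
  rewrite big_split /= (sum_shift (fun w => f w * f (w + h) / 2)).
  rewrite -big_split; apply: eq_bigr => w _ /=; by rewrite /f; field.
have -> : sqmass g ^+ 2 =
    qmass g + \sum_(h : F * F | h != 0) \sum_(w : F * F) f w * f (w + h).
  by rewrite -[LHS](sum_pair_shift f) (bigD1 (0 : F * F)) //= -sq4.
ring.
Qed.

Lemma norm_energy_le (C : numClosedFieldType) (F : finFieldType)
    (g : F * F -> C) :
  `|energy g| <= (#|F|%:R + 1) * sqmass g ^+ 2 - #|F|%:R * qmass g.
Proof.
rewrite -sum_side_bound.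
do 3!(apply: le_trans (ler_norm_sum _ _ _) _; apply: ler_sum => ? _).
exact: side_boundP.
Qed.

(** Here [sqmass g / N] is the mean of [|g|^2] over the N points. Cauchy-Schwarz is kept as an
    identity so that its equality case can be read off. *)
Lemma qmass_variance (C : numClosedFieldType) (F : finFieldType)
    (g : F * F -> C) (N := #|F|%:R ^+ 2 : C) :
  \sum_(w : F * F) (`|g w| ^+ 2 - sqmass g / N) ^+ 2 =
  qmass g - sqmass g ^+ 2 / N.
Proof.
have N0 : N != 0.
  by rewrite expf_neq0 // natr_card_neq0.
have cN : #|{: F * F}|%:R = N by rewrite card_prod natrM -expr2.
set c := sqmass g / N.
transitivity (\sum_(w : F * F) (`|g w| ^+ 4 - (2 * c) * `|g w| ^+ 2 + c ^+ 2)).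
  by apply: eq_bigr => w _; ring.
rewrite big_split sumrB -mulr_sumr sumr_const /= -[X in _ + X]mulr_natr cN.
by rewrite -/(qmass g) -/(sqmass g) /c; field.
Qed.

(** The constant for unnormalised sums: q times 1 + 1/q - 1/q^2. *)
Definition sharp_const (C : numClosedFieldType) (q : nat) : C :=
  q%:R + 1 - q%:R^-1.

Lemma energy_defect (C : numClosedFieldType) (F : finFieldType)
    (g : F * F -> C) (q := #|F|%:R : C) :
  (q + 1) * sqmass g ^+ 2 - q * qmass g =
  sharp_const C #|F| * sqmass g ^+ 2
  - q * \sum_(w : F * F) (`|g w| ^+ 2 - sqmass g / q ^+ 2) ^+ 2.
Proof.
have q0 : q != 0 := natr_card_neq0 C F.
by rewrite qmass_variance /sharp_const -/q; field.
Qed.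

Lemma sqmass_real (C : numClosedFieldType) (F : finFieldType)
    (g : F * F -> C) : sqmass g \is Num.real.
Proof. by apply: sum_real => w _; rewrite realX ?normr_real. Qed.

(** Squares in [C] are nonnegative only for real bases, hence this side condition for the
    variance. *)
Lemma dev_real (C : numClosedFieldType) (F : finFieldType)
    (g : F * F -> C) (w : F * F) (m : nat) :
  `|g w| ^+ 2 - sqmass g / m%:R ^+ 2 \is Num.real.
Proof.
by rewrite realB ?realX ?normr_real // realM ?sqmass_real // realV realX ?realn.
Qed.

Lemma energy_le (C : numClosedFieldType) (F : finFieldType)
    (g : F * F -> C) :
  `|energy g| <= sharp_const C #|F| * sqmass g ^+ 2.
Proof.
apply: le_trans (norm_energy_le g) _.
rewrite energy_defect lerBlDr lerDl mulr_ge0 ?ler0n // sumr_ge0 // => w _.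
by rewrite real_exprn_even_ge0 // dev_real.
Qed.

(** Equality in the total bound forces equality at each stage: the variance vanishes, so [|g|] is
    constant, and every summand equals its side bound. *)
Lemma energy_extremal (C : numClosedFieldType) (F : finFieldType)
    (g : F * F -> C) :
  energy g = sharp_const C #|F| * sqmass g ^+ 2 ->
  (exists w, g w != 0) ->
  exists2 r : C, 0 < r & (forall w, `|g w| = r) /\
    forall w h u, orth h u -> g (w + h) * g (w + u) = g w * g (w + h + u).
Proof.
move=> E [w0 gw0].
have qp : 0 < #|F|%:R :> C by rewrite ltr0n card_field_gt0.
have dev0 w : `|g w| ^+ 2 = sqmass g / #|F|%:R ^+ 2.
  have ge0 v : v \in predT -> 0 <= (`|g v| ^+ 2 - sqmass g / #|F|%:R ^+ 2) ^+ 2.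
    by move=> _; rewrite real_exprn_even_ge0 // dev_real.
  have s0 : 0 <= \sum_(w : F * F) (`|g w| ^+ 2 - sqmass g / #|F|%:R ^+ 2) ^+ 2.
    exact: sumr_ge0.
  have := norm_energy_le g; rewrite energy_defect -E.
  have -> : `|energy g| = energy g.
    apply: ger0_norm; rewrite E mulr_ge0 //.
      rewrite /sharp_const -addrA addr_ge0 ?ler0n // subr_ge0.
      by rewrite invf_le1 // ler1n card_field_gt0.
    by rewrite real_exprn_even_ge0 // sqmass_real.
  rewrite lerBrDr gerDl pmulr_rle0 // => s1.
  have /eqP : \sum_(w : F * F) (`|g w| ^+ 2 - sqmass g / #|F|%:R ^+ 2) ^+ 2 = 0.
    by apply/eqP; rewrite eq_le s1 s0.
  rewrite psumr_eq0 // => /allP /(_ w); rewrite mem_index_enum => /(_ isT).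
  by rewrite /= sqrf_eq0 subr_eq0 => /eqP.
have gr w : `|g w| = `|g w0|.
  by apply/eqP; rewrite -(eqrXn2 (n := 2)) // !dev0.
exists `|g w0|; first by rewrite normr_gt0.
split=> // w h u hu.
(* The triple sum is flattened to one index: when each term is bounded in norm by [B] and the sums
   agree, the terms agree one by one. *)
pose T (i : (F * F) * ((F * F) * (F * F))) :=
  g (i.1 + i.2.1) * g (i.1 + i.2.2) * (g i.1 * g (i.1 + i.2.1 + i.2.2))^*%R.
pose B (i : (F * F) * ((F * F) * (F * F))) := side_bound g i.1 i.2.1 i.2.2.
have TB : \sum_(i | orth i.2.1 i.2.2) T i = \sum_(i | orth i.2.1 i.2.2) B i.
  rewrite -(pair_big_dep xpredT (fun w hu => orth hu.1 hu.2)
    (fun w hu => T (w, hu))) /=.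
  rewrite -(pair_big_dep xpredT (fun w hu => orth hu.1 hu.2)
    (fun w hu => B (w, hu))) /=.
  transitivity (energy g).
    apply: eq_bigr => v _.
    by rewrite -(pair_big_dep xpredT (@orth F) (fun h u => T (v, (h, u)))).
  transitivity (\sum_(w : F * F) \sum_(h : F * F) \sum_(u : F * F | orth h u)
      side_bound g w h u).
    rewrite sum_side_bound energy_defect E big1 ?mulr0 ?subr0 // => v _.
    by rewrite dev0 subrr expr0n.
  apply: eq_bigr => v _.
  by rewrite -(pair_big_dep xpredT (@orth F) (fun h u => B (v, (h, u)))).
have := @normC_sum_upper C _ _ T B
  (fun i _ => side_boundP g i.1 i.2.1 i.2.2) TB.
move=> /(_ (w, (h, u)) hu); rewrite /T /B /= => TBi.
have {TBi} : g (w + h) * g (w + u) * (g w * g (w + h + u))^*%R = `|g w0| ^+ 4.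
  rewrite TBi /side_bound !gr; case: ifP => _; [ring | by field].
(* Both [x * y^*] and [y * y^*] equal the same fourth power, so the nonzero [y^*] cancels. *)
set x := g (w + h) * _; set y := g w * _ => xy.
have yy : y * y^*%R = `|g w0| ^+ 4.
  by rewrite -normCK /y normrM !gr; ring.
have y0 : y^*%R != 0.
  rewrite fmorph_eq0 -normr_eq0 /y normrM !gr mulf_neq0 // normr_eq0 //.
by apply: (mulIf y0); rewrite xy yy.
Qed.

(** The rectangle identity turns each summand into r^4, which is also its side bound, and a constant
    modulus has zero variance. *)
Lemma extremal_energy (C : numClosedFieldType) (F : finFieldType)
    (g : F * F -> C) (r : C) :
  (forall w, `|g w| = r) ->
  (forall w h u, orth h u -> g (w + h) * g (w + u) = g w * g (w + h + u)) ->
  energy g = sharp_const C #|F| * sqmass g ^+ 2.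
Proof.
move=> gr gg.
have q0 := natr_card_neq0 C F.
transitivity ((#|F|%:R + 1) * sqmass g ^+ 2 - #|F|%:R * qmass g).
  rewrite -sum_side_bound; do 2!(apply: eq_bigr => ? _).
  apply: eq_bigr => u hu; rewrite gg // -normCK normrM /side_bound !gr.
  case: ifP => _; [ring | by field].
rewrite energy_defect big1 ?mulr0 ?subr0 // => v _.
have -> : sqmass g = r ^+ 2 * #|F|%:R ^+ 2.
  rewrite /sqmass; under eq_bigr do rewrite gr.
  by rewrite sumr_const -[LHS]mulr_natr card_prod natrM -expr2.
by rewrite gr mulfK ?subrr ?expr0n // expf_neq0.
Qed.

(** * Characters of finite abelian groups and self-duality of [F] *)

(** Translation by [x0] leaves the sum unchanged, yet multiplies it by [psi x0], which is not 1. *)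
Lemma sum_char (C : idomainType) (G : finZmodType) (psi : G -> C) :
  {morph psi : x y / x + y >-> x * y} -> (exists x, psi x != 1) ->
  \sum_x psi x = 0.
Proof.
move=> psiD [x0 x01]; apply/eqP.
have : (psi x0 - 1) * \sum_x psi x == 0.
  rewrite mulrBl mul1r subr_eq0 big_distrr /= [eqbRHS](reindex_inj (addrI x0)).
  by apply/eqP/eq_bigr => x _; rewrite psiD.
by rewrite mulf_eq0 subr_eq0 (negPf x01).
Qed.

(** Self-duality of the additive group: [a] is a frequency at which the Fourier transform of [psi]
    does not vanish. *)
Lemma char_dual (C : numFieldType) (F : finFieldType) (chi psi : F -> C) :
  chi 0 = 1 -> {morph chi : x y / x + y >-> x * y} ->
  (exists x, chi x != 1) ->
  psi 0 = 1 -> {morph psi : x y / x + y >-> x * y} ->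
  exists a, forall x, psi x = chi (a * x).
Proof.
move=> chi0 chiD [x0 x01] psi0 psiD.
(* The sums over x of psi x chi (- a x) add up to #|F| over all a, so one of
   them does not vanish. *)
pose S a := \sum_x psi x * chi (- (a * x)).
have sumS : \sum_a S a = #|F|%:R.
  rewrite exchange_big (bigD1 0) //= [X in _ + X]big1 => [|x x_neq0].
    under eq_bigr do rewrite mulr0 oppr0 chi0 psi0 mul1r.
    by rewrite sumr_const addr0.
  rewrite -big_distrr /= (@sum_char _ _ (fun a => chi (- (a * x)))) ?mulr0 //.
    by move=> a b; rewrite mulrDl opprD chiD.
  by exists (- (x0 / x)); rewrite mulNr opprK divfK.
have [a Sa] : exists a, S a != 0.
  apply/existsP; apply: contraT; rewrite negb_exists => /forallP S0.
  move: sumS; rewrite big1 => [/esym/eqP|a _]; last first.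
    by apply/eqP; rewrite -[_ == _]negbK S0.
  by rewrite pnatr_eq0 => /eqP/card0_eq/(_ 0).
(* If [psi] differed from [chi (a * _)] at [x], their quotient would be a nontrivial character and
   [S a] would be zero. *)
exists a => x; apply/eqP; apply: contraNT Sa => psix; apply/eqP.
apply: sum_char => [y z|].
  by rewrite psiD mulrDr opprD chiD; ring.
exists x; apply: contra psix => /eqP E; rewrite -[psi x]mulr1 -chi0.
by rewrite -(addNr (a * x)) chiD mulrA E mul1r.
Qed.

(** * The rectangle identity as a functional equation *)

Lemma orth_multiplicative (C : numFieldType) (F : finFieldType)
    (chi : F -> C) (g : F * F -> C) :
  chi 0 = 1 -> {morph chi : x y / x + y >-> x * y} ->
  (exists x, chi x != 1) ->
  g 0 = 1 -> (forall w, g w != 0) ->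
  (forall w h u, orth h u -> g (w + h) * g (w + u) = g w * g (w + h + u)) ->
  exists a b c, forall w, g w = chi (a * w.1 + b * w.2 + c * (w.1 * w.2)).
Proof.
move=> chi0 chiD chi1 g0 gn0 gD.
(* Each axis is isotropic for the polar form, so two vectors on it form an admissible pair. *)
have gX x1 x2 y : g (x1, y) * g (x2, y) = g (0, y) * g (x1 + x2, y).
  have := gD (0, y) (x1, 0) (x2, 0); rewrite /orth /= mulr0 mul0r addr0 eqxx.
  by move=> /(_ isT); rewrite /GRing.add /= /add_pair /= !add0r !addr0.
have gY x y1 y2 : g (x, y1) * g (x, y2) = g (x, 0) * g (x, y1 + y2).
  have := gD (x, 0) (0, y1) (0, y2); rewrite /orth /= mulr0 mul0r addr0 eqxx.
  by move=> /(_ isT); rewrite /GRing.add /= /add_pair /= !add0r !addr0.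
have g00 : g (0, 0) = 1 by [].
have [a ga] : exists a, forall x, g (x, 0) = chi (a * x).
  apply: char_dual => // x y /=; by rewrite gX g00 mul1r.
have [b gb] : exists b, forall y, g (0, y) = chi (b * y).
  apply: char_dual => // x y /=; by rewrite gY g00 mul1r.
(* Dividing out the two axis characters leaves a function that is trivial on the axes. *)
pose phi x y := g (x, y) / (g (x, 0) * g (0, y)).
have phiE x y : g (x, y) = phi x y * (g (x, 0) * g (0, y)).
  by rewrite divfK // mulf_neq0.
have phiX x1 x2 y : phi (x1 + x2) y = phi x1 y * phi x2 y.
  have E : g (x1 + x2, y) = g (x1, y) * g (x2, y) / g (0, y).
    by rewrite gX mulrAC divff ?mul1r.
  have E0 : g (x1 + x2, 0) = g (x1, 0) * g (x2, 0).
    by rewrite gX g00 mul1r.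
  by rewrite /phi E E0; field; rewrite !gn0.
have phiY x y1 y2 : phi x (y1 + y2) = phi x y1 * phi x y2.
  have E : g (x, y1 + y2) = g (x, y1) * g (x, y2) / g (x, 0).
    by rewrite gY mulrAC divff ?mul1r.
  have E0 : g (0, y1 + y2) = g (0, y1) * g (0, y2).
    by rewrite gY g00 mul1r.
  by rewrite /phi E E0; field; rewrite !gn0.
have phi0 x : phi x 0 = 1 by rewrite /phi g00 mulr1 divff.
have phin0 x y : phi x y != 0 by rewrite mulf_neq0 // invr_neq0 // mulf_neq0.
(* Orthogonality of (s, t) and (k s, - k t). *)
have swap s k t : phi s (k * t) = phi (k * s) t.
  have := gD 0 (s, t) (k * s, - (k * t)).
  rewrite /orth /= mulrN mulrCA [t * _]mulrCA [t * s]mulrC addNr eqxx.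
  move=> /(_ isT); rewrite g0 mul1r !add0r.
  rewrite [(s, t) + _](_ : _ = (s + k * s, t - k * t)) //.
  rewrite (phiE s t) (phiE (k * s) (- (k * t))).
  rewrite (phiE (s + k * s)).
  rewrite !ga !gb !mulrDr !chiD !phiX !phiY.
  set A := chi _; set B := chi _; set A' := chi _; set B' := chi _.
  have n0 x : chi x != 0.
    apply/eqP => chix; have := chiD x (- x).
    by rewrite subrr chi0 chix mul0r => /eqP; rewrite oner_eq0.
  move=> E.
  (* After expansion the axis factors and the two unmixed values of [phi] occur on both sides;
     cancelling them leaves the mixed values. *)
  have E1 : phi s (- (k * t)) * phi (k * s) t = 1.
    apply: (mulfI (phin0 s t)); apply: (mulfI (phin0 (k * s) (- (k * t)))).
    apply: (mulfI (n0 (a * s))); apply: (mulfI (n0 (b * t))).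
    apply: (mulfI (n0 (a * (k * s)))); apply: (mulfI (n0 (b * - (k * t)))).
    rewrite -/A -/B -/A' -/B'.
    transitivity (phi s t * (A * B) * (phi (k * s) (- (k * t)) * (A' * B'))).
      by rewrite E; ring.
    by ring.
  rewrite -[LHS]mulr1 -E1 mulrA -phiY subrr phi0 mul1r //.
have [c gc] : exists c, forall x, phi x 1 = chi (c * x).
  apply: char_dual => //.
  by rewrite /phi g00 mul1r divff.
(* Taking k = y and t = 1 in [swap] moves [y] into the first argument, where [c] describes [phi]. *)
exists a, b, c => -[x y] /=; rewrite phiE -[in phi x y](mulr1 y) swap gc.
by rewrite ga gb -!chiD; congr chi; ring.
Qed.

(** Around a parallelogram the linear part of the exponent cancels and the product part leaves [c]
    times the polar form. *)
Lemma multiplicative_orth (C : pzRingType) (F : finFieldType)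
    (chi : F -> C) (a b c : F) (w h u : F * F) :
  {morph chi : x y / x + y >-> x * y} ->
  let g w := chi (a * w.1 + b * w.2 + c * (w.1 * w.2)) in
  orth h u -> g (w + h) * g (w + u) = g w * g (w + h + u).
Proof.
move=> chiD g /eqP hu; rewrite /g -!chiD; congr chi.
case: w h u hu => [w1 w2] [h1 h2] [u1 u2] /= hu.
apply/eqP; rewrite -subr_eq0; apply/eqP.
by transitivity (- c * (h1 * u2 + h2 * u1)); [ring | rewrite hu mulr0].
Qed.

(** * The standard character of [F] *)

Lemma expi0 (R : realType) : expi (0 : R) = 1.
Proof. by rewrite /expi cos0 sin0. Qed.

Lemma expiD (R : realType) (s t : R) : expi (s + t) = expi s * expi t.
Proof. by rewrite /expi cosD sinD; congr (_ +i* _); rewrite addrC. Qed.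

Lemma expi_mulrn (R : realType) (t : R) (m : nat) :
  expi (t * m%:R) = expi t ^+ m.
Proof.
elim: m => [|m IH]; first by rewrite mulr0 expi0.
by rewrite -[m.+1]addn1 natrD mulrDr mulr1 expiD IH exprD expr1.
Qed.

Lemma norm_expi (R : realType) (t : R) : `|expi t| = 1.
Proof. by rewrite normc_def /= cos2Dsin2 Num.Theory.sqrtr1. Qed.

Lemma expi_2pi (R : realType) : expi (2 * pi : R) = 1.
Proof. by rewrite mulrC mulr_natr /expi cos2pi sin2pi. Qed.

Definition std_char (R : realType) (F : finFieldType) (p n : nat) (x : F) :
    R[i] :=
  expi (2 * pi * (prime_rep p (trace p n x))%:R / p%:R).

Lemma std_charE (R : realType) (F : finFieldType) (p n : nat) (x : F) :
  std_char R p n x = expi (2 * pi / p%:R) ^+ prime_rep p (trace p n x).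
Proof. by rewrite -expi_mulrn mulrAC. Qed.

Lemma expi_root (R : realType) (p : nat) :
  (0 < p)%N -> expi (2 * pi / p%:R : R) ^+ p = 1.
Proof.
by move=> p0; rewrite -expi_mulrn divfK ?expi_2pi // pnatr_eq0 -lt0n.
Qed.

Lemma expi_root_neq1 (R : realType) (p m : nat) :
  (0 < m < p)%N -> expi (2 * pi / p%:R : R) ^+ m != 1.
Proof.
case/andP=> m0 mp; have p0 : (0 < p)%N by exact: leq_trans mp.
(* The half angle [t] lies in (0, pi), where the sine is positive, so cos 2t = 1 - 2 sin^2 t differs
   from 1. *)
rewrite -expi_mulrn; set t : R := pi / p%:R * m%:R.
have -> : 2 * pi / p%:R * m%:R = t + t by rewrite /t; ring.
have st : 0 < sin t.
  apply: sin_gt0_pi; apply/andP; split.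
    by rewrite !mulr_gt0 ?invr_gt0 ?ltr0n ?pi_gt0.
  by rewrite /t mulrAC ltr_pdivrMr ?ltr0n // ltr_pM2l ?pi_gt0 // ltr_nat.
apply/eqP => -[/eqP + _]; rewrite cosD.
have := cos2Dsin2 t; rewrite !expr2 => E.
have -> : cos t * cos t - sin t * sin t = 1 - 2 * (sin t * sin t).
  by move: E; lra.
rewrite -subr_eq0 addrAC subrr add0r oppr_eq0 !mulf_eq0 pnatr_eq0.
by rewrite (gt_eqF st).
Qed.

Lemma std_char0 (R : realType) (F : finFieldType) (p n : nat) :
  (0 < p)%N -> std_char R p n (0 : F) = 1.
Proof.
case: p => // p _; rewrite std_charE /trace big1 => [|i _]; last first.
  by rewrite expr0n eqn0Ngt expn_gt0.
by rewrite /prime_rep /= eqxx expr0.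
Qed.

Lemma trace_additive (F : finFieldType) (p n : nat) (x y : F) :
  p \in [pchar F] -> trace p n (x + y) = trace p n x + trace p n y.
Proof.
move=> ch; rewrite /trace -big_split /=; apply: eq_bigr => i _.
by rewrite exprDn_pchar // pnatX pnatE ?(pcharf_prime ch) ?ch.
Qed.

Lemma natr_inj_mod (F : nzRingType) (p m m' : nat) :
  p \in [pchar F] -> m%:R = m'%:R :> F -> m = m' %[mod p].
Proof.
move=> ch; wlog le : m m' / (m <= m')%N.
  by move=> H; case: (leqP m m') => [/H|/ltnW/H] // H' /esym /H' ->.
move=> E; apply/eqP; rewrite eq_sym eqn_mod_dvd // (dvdn_pcharf ch) natrB //.
by rewrite E subrr.
Qed.

(** Representatives in {0, ..., p-1} add only modulo p, which suffices because the base is a p-th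
    root of unity. *)
Lemma std_charD (R : realType) (F : finFieldType) (p n : nat) :
  prime p -> #|F| = (p ^ n)%N ->
  {morph (std_char R p n : F -> R[i]) : x y / x + y >-> x * y}.
Proof.
move=> pp cF x y; have ch : p \in [pchar F] := card_finPcharP cF pp.
rewrite !std_charE -exprD.
have [_ tx] := trace_repP x pp cF; have [_ ty] := trace_repP y pp cF.
have [_ txy] := trace_repP (x + y) pp cF.
rewrite -(expr_mod _ (expi_root R (prime_gt0 pp))).
rewrite -[RHS](expr_mod _ (expi_root R (prime_gt0 pp))); congr (_ ^+ _).
by apply: (natr_inj_mod ch); rewrite natrD tx ty txy trace_additive.
Qed.

(** The trace is a nonzero polynomial of degree at most p^(n-1), too small to vanish at all p^n
    elements. *)
Lemma trace_neq0 (F : finFieldType) (p n : nat) :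
  prime p -> #|F| = (p ^ n)%N -> exists x : F, trace p n x != 0.
Proof.
move=> pp cF.
have n0 : (0 < n)%N.
  by case: n cF => // cF; have := finNzRing_gt1 F; rewrite cF.
have p1 := prime_gt1 pp.
pose P : {poly F} := \sum_(i < n) 'X^(p ^ i).
have P0 : P != 0.
  (* The coefficient of X is 1, since only i = 0 gives the exponent 1. *)
  apply/eqP => /(congr1 (fun Q : {poly F} => Q`_1)); rewrite coef_sum coef0.
  case: n n0 cF @P => // m _ _ _.
  rewrite big_ord_recl expn0 coefXn eqxx big1 ?addr0 => [/eqP|i _].
    by rewrite oner_eq0.
  by rewrite coefXn eq_sym -[1%N](expn0 p) eqn_exp2l.
have sP : (size P <= (p ^ n.-1).+1)%N.
  apply: leq_trans (size_sum _ _ _) _; apply/bigmax_leqP => i _.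
  by rewrite size_polyXn ltnS leq_pexp2l ?prime_gt0 // -ltnS prednK.
apply/existsP; apply: contraT; rewrite negb_exists => /forallP t0.
have := max_poly_roots P0 (rs := enum F) _ (enum_uniq F).
rewrite -cardE cF => /(_ _) H.
have : (p ^ n < size P)%N.
  apply: H; apply/allP => x _; rewrite /root /P horner_sum.
  under eq_bigr do rewrite hornerXn.
  by have := t0 x; rewrite negbK.
move=> /leq_trans /(_ sP); rewrite ltnS -{1}(prednK n0) leqNgt.
by rewrite ltn_exp2l ?ltnSn.
Qed.

Lemma std_char_neq1 (R : realType) (F : finFieldType) (p n : nat) :
  prime p -> #|F| = (p ^ n)%N -> exists x : F, std_char R p n x != 1.
Proof.
move=> pp cF; have [x tx] := trace_neq0 pp cF; exists x.
have [lt E] := trace_repP x pp cF.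
rewrite std_charE expi_root_neq1 // lt andbT lt0n.
by apply: contra tx => /eqP E0; rewrite -E E0.
Qed.

(** * Null coordinates on the surface *)

Lemma odd_card_two_neq0 (F : finFieldType) (p n : nat) :
  prime p -> odd p -> #|F| = (p ^ n)%N -> (2 : F) != 0.
Proof.
move=> pp op cF; have ch : p \in [pchar F] := card_finPcharP cF pp.
rewrite -(dvdn_pcharf ch) dvdn_prime2 //.
by apply: contraTneq op => ->.
Qed.

Definition hpoint (F : finFieldType) (w : F * F) : points (H2 F) :=
  H2_point (w.1 + w.2) (w.1 - w.2).

Lemma row3P (T : Type) (A B : 'rV[T]_3) :
  A 0 0 = B 0 0 -> A 0 1 = B 0 1 -> A 0 2 = B 0 2 -> A = B.
Proof.
move=> A0 A1 A2; apply/rowP => -[[|[|[|//]]] Hi].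
- by rewrite (_ : Ordinal Hi = 0) //; apply: val_inj.
- by rewrite (_ : Ordinal Hi = 1) //; apply: val_inj.
- by rewrite (_ : Ordinal Hi = 2) //; apply: val_inj.
Qed.

(** Halving inverts the coordinate change; the third coordinate is recovered from the equation of
    the surface. *)
Lemma hpoint_bij (F : finFieldType) : (2 : F) != 0 -> bijective (@hpoint F).
Proof.
move=> two0.
exists (fun xi : points (H2 F) =>
  (((val xi 0 0 + val xi 0 1) / 2, (val xi 0 0 - val xi 0 1) / 2) : F * F)).
  by move=> [x y]; rewrite /= !mxE /=; congr pair; field.
move=> [v vH]; apply: val_inj; have := vH; rewrite inE => /eqP v2.
by apply: row3P; rewrite !mxE /= ?v2; field.
Qed.

Lemma card_H2 (F : finFieldType) : (2 : F) != 0 -> #|H2 F| = (#|F| ^ 2)%N.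
Proof.
move=> /hpoint_bij /bij_eq_card E; rewrite -card_sig.
by rewrite -[LHS]E card_prod mulnn.
Qed.

Definition chart (R : realType) (F : finFieldType) (f : points (H2 F) -> R[i])
    (w : F * F) : R[i] := f (hpoint w).

Lemma sum_hpoint (V : nmodType) (F : finFieldType) (G : points (H2 F) -> V) :
  (2 : F) != 0 ->
  \sum_(xi : points (H2 F)) G xi = \sum_(w : F * F) G (hpoint w).
Proof.
by move=> two0; rewrite (reindex _ (onW_bij _ (hpoint_bij two0))).
Qed.

(** * The fourth moment of the extension *)

Lemma dotDr (F : finFieldType) (d : nat) (x u v : 'rV[F]_d) :
  dot x (u + v) = dot x u + dot x v.
Proof.
by rewrite /dot -big_split; apply: eq_bigr => i _; rewrite mxE mulrDr.
Qed.

Lemma dotNr (F : finFieldType) (d : nat) (x u : 'rV[F]_d) :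
  dot x (- u) = - dot x u.
Proof. by rewrite /dot -sumrN; apply: eq_bigr => i _; rewrite mxE mulrN. Qed.

Lemma dotDl (F : finFieldType) (d : nat) (x y u : 'rV[F]_d) :
  dot (x + y) u = dot x u + dot y u.
Proof.
by rewrite /dot -big_split; apply: eq_bigr => i _; rewrite mxE mulrDl.
Qed.

Lemma sum_char_dot (C : numFieldType) (F : finFieldType) (d : nat)
    (e : F -> C) (v : 'rV[F]_d) :
  e 0 = 1 -> {morph e : x y / x + y >-> x * y} -> (exists x, e x != 1) ->
  \sum_(x : 'rV[F]_d) e (dot x v) = if v == 0 then #|F|%:R ^+ d else 0.
Proof.
move=> e0 eD [x0 x01]; case: eqVneq => [->|v0].
  under eq_bigr => x _.
    rewrite /dot big1 ?e0 => [|i _]; last by rewrite mxE mulr0.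
    over.
  by rewrite sumr_const card_mx mul1n natrX.
have [i vi] : exists i, v 0 i != 0.
  apply/existsP; apply: contraT; rewrite negb_exists => /forallP v_0.
  case/eqP: v0; apply/rowP => i; rewrite mxE; apply/eqP.
  by rewrite -[_ == _]negbK v_0.
apply: (@sum_char C 'rV[F]_d (fun x => e (dot x v))).
  by move=> x y; rewrite dotDl eD.
(* This multiple of a basis vector has dot product [x0] with [v]. *)
exists ((x0 / v 0 i) *: delta_mx 0 i).
rewrite /dot (bigD1 i) //= big1 => [|j ji].
  by rewrite !mxE !eqxx mulr1 addr0 divfK.
by rewrite !mxE (negPf ji) andbF mulr0 mul0r.
Qed.

(** The sum and difference of the first two coordinates, halved, force the fourth vertex of the
    parallelogram; the third coordinate is then -4 times the polar form. *)
Lemma hpoint_energy_eq (F : finFieldType) (w h u v : F * F) : (2 : F) != 0 ->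
  (val (hpoint (w + h)) + val (hpoint (w + u)) - val (hpoint w) - val (hpoint v)
     == 0) = orth h u && (v == w + h + u).
Proof.
move=> two0; case: w h u v => [w1 w2] [h1 h2] [u1 u2] [v1 v2].
apply/eqP/andP => [E|[/eqP ortho /eqP [-> ->]]]; last first.
  rewrite /orth /= in ortho.
  apply: row3P; rewrite !mxE /=; [ring | ring |].
  transitivity (- (2 * 2) * (h1 * u2 + h2 * u1)); first by ring.
  by rewrite ortho mulr0.
have E0 := congr1 (fun M : 'rV_3 => M 0 0) E.
have E1 := congr1 (fun M : 'rV_3 => M 0 1) E.
have E2 := congr1 (fun M : 'rV_3 => M 0 2) E.
rewrite !mxE /= in E0 E1 E2.
have v1E : v1 = w1 + h1 + u1.
  apply: (mulfI two0); apply/eqP; rewrite -subr_eq0 -oppr_eq0; apply/eqP.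
  by rewrite -[RHS](addr0 0) -[X in _ = X + _]E0 -[X in _ = _ + X]E1; ring.
have v2E : v2 = w2 + h2 + u2.
  apply: (mulfI two0); apply/eqP; rewrite -subr_eq0; apply/eqP.
  by rewrite -[RHS](subr0 0) -[X in _ = X - _]E1 -[X in _ = _ - X]E0; ring.
rewrite v1E v2E; split=> //; rewrite /orth /=; apply/eqP.
have four0 : (- (2 * 2) : F) != 0 by rewrite oppr_eq0 mulf_neq0.
apply: (mulfI four0); rewrite mulr0 -[RHS]E2 v1E v2E; ring.
Qed.

(** Links the real-valued modulus of the definitions to the norm of [R[i]], in which the energy
    estimates are stated. *)
Lemma normcC (R : rcfType) (z : R[i]) : `|z| = (Normc.normc z)%:C.
Proof. by case: z => a b; rewrite normc_def. Qed.

Lemma nontrivial_char0 (R : realType) (F : finFieldType) (e : F -> R[i]) :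
  nontrivial_additive_character e -> e 0 = 1.
Proof.
case=> e1 eD _; have e00 : e 0 != 0.
  by rewrite -normr_eq0 normcC e1 oner_eq0.
by apply: (mulfI e00); rewrite -eD addr0 mulr1.
Qed.

Lemma nontrivial_charN (R : realType) (F : finFieldType) (e : F -> R[i])
    (x : F) :
  nontrivial_additive_character e -> e (- x) = (e x)^*%R.
Proof.
move=> he; have e0 := nontrivial_char0 he; case: he => e1 eD _.
have ex0 : e x != 0 by rewrite -normr_eq0 normcC e1 oner_eq0.
by apply: (mulfI ex0); rewrite -eD subrr e0 -normCK normcC e1 expr1n.
Qed.

Lemma prod4_sum (C : comPzRingType) (I : finType) (a b c d : I -> C) :
  (\sum_i a i) * ((\sum_i b i) * ((\sum_i c i) * (\sum_i d i))) =
  \sum_i \sum_j \sum_k \sum_l a i * (b j * (c k * d l)).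
Proof.
rewrite mulr_suml; apply: eq_bigr => i _.
rewrite mulr_suml mulr_sumr; apply: eq_bigr => j _.
rewrite mulr_suml 2!mulr_sumr; apply: eq_bigr => k _.
by rewrite 3!mulr_sumr.
Qed.

(** Summing over [x] first, orthogonality of characters keeps exactly the rectangles, with weight
    q^3 against the factor |H2|^-4 = q^-8. *)
Lemma sum_extension4 (R : realType) (F : finFieldType) (e : F -> R[i])
    (f : points (H2 F) -> R[i]) :
  (2 : F) != 0 -> nontrivial_additive_character e ->
  \sum_(x : 'rV[F]_3) `|extension e f x| ^+ 4 =
  #|F|%:R ^- 5 * energy (chart f).
Proof.
move=> two0 he; have e0 := nontrivial_char0 he.
have eN x := nontrivial_charN x he; have [e1 eD ent] := he.
have q0 := natr_card_neq0 R[i] F.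
have conjM (x y : R[i]) : (x * y)^*%R = x^*%R * y^*%R by exact: rmorphM.
pose g := chart f; pose P (w : F * F) : 'rV[F]_3 := val (hpoint w).
pose s x := \sum_(w : F * F) g w * e (dot x (P w)).
have extE x : extension e f x = #|F|%:R ^- 2 * s x.
  by rewrite /extension (card_H2 two0) natrX (sum_hpoint _ two0).
have n4 x : `|extension e f x| ^+ 4 =
    #|F|%:R ^- 8 * \sum_(w : F * F) \sum_(w1 : F * F) \sum_(w2 : F * F)
      \sum_(w4 : F * F)
      g w1 * g w2 * (g w * g w4)^*%R * e (dot x (P w1 + P w2 - P w - P w4)).
  rewrite extE normrM exprMn normfV normrX normr_nat.
  congr (_ * _); first by rewrite exprVn -exprM.
  (* A conjugated factor comes first so that the outermost index is the base vertex [w]. *)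
  have -> : `|s x| ^+ 4 = (s x)^*%R * (s x * (s x * (s x)^*%R)).
    by rewrite (exprM _ 2 2) normCK; ring.
  rewrite /s raddf_sum prod4_sum; do 4!(apply: eq_bigr => ? _).
  rewrite /= !conjM -!eN !dotDr !dotNr !eD; ring.
under eq_bigr do rewrite n4.
rewrite -mulr_sumr /=.
have -> : #|F|%:R ^- 5 = #|F|%:R ^- 8 * #|F|%:R ^+ 3 :> R[i].
  by field.
rewrite -mulrA; congr (_ * _); rewrite /energy mulr_sumr exchange_big /=.
apply: eq_bigr => w _; rewrite mulr_sumr exchange_big /=.
(* Here and below, a neighbour of [w] is written as [w] plus a side. *)
rewrite [LHS](reindex_inj (addrI w)) /=; apply: eq_bigr => h _.
rewrite mulr_sumr exchange_big /= [LHS](reindex_inj (addrI w)) /=.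
rewrite [RHS]big_mkcond; apply: eq_bigr => u _; rewrite exchange_big /=.
under eq_bigr do
  rewrite -mulr_sumr /= (sum_char_dot _ e0 eD ent) hpoint_energy_eq //.
case: ifP => hu /=; last by rewrite big1 // => v _; rewrite mulr0.
rewrite (bigD1 (w + h + u)) //= eqxx big1 ?addr0 => [|v /negPf ->].
  2: by rewrite mulr0.
by rewrite mulrC.
Qed.

(** * Norms as real powers and the sharp inequality *)

Lemma powR4K (R : realType) (x : R) : 0 <= x -> (x `^ 4^-1) ^+ 4 = x.
Proof.
by move=> x0; rewrite -(powR_mulrn 4 (powR_ge0 _ _)) -powRrM mulVf ?powRr1.
Qed.

Lemma norm_dx4 (R : realType) (F : finFieldType) (g : 'rV[F]_3 -> R[i]) :
  (norm_dx 4 g ^+ 4)%:C = \sum_x `|g x| ^+ 4.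
Proof.
rewrite /norm_dx powR4K; last by apply: sumr_ge0 => x _; exact: powR_ge0.
rewrite rmorph_sum; apply: eq_bigr => x _ /=; rewrite normcC -rmorphXn /=.
have n0 : 0 <= Normc.normc (g x) by rewrite -ler0c -normcC.
by rewrite -(powR_mulrn 4 n0).
Qed.

(** The fourth power of an L^2 norm is the square of a mean over q^2 points, hence the factor
    q^-4. *)
Lemma norm_sigma4 (R : realType) (F : finFieldType)
    (f : points (H2 F) -> R[i]) :
  (2 : F) != 0 ->
  (norm_sigma 2 f ^+ 4)%:C = #|F|%:R ^- 4 * sqmass (chart f) ^+ 2.
Proof.
move=> two0; rewrite /norm_sigma.
set S := \sum_(_ : _) _.
have S0 : 0 <= S by apply: sumr_ge0 => x _; exact: powR_ge0.
have SE : S%:C = sqmass (chart f).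
  rewrite /S (sum_hpoint _ two0) rmorph_sum; apply: eq_bigr => w _ /=.
  rewrite normcC -rmorphXn /=.
  have n0 : 0 <= Normc.normc (chart f w) by rewrite -ler0c -normcC.
  by rewrite -(powR_mulrn 2 n0).
set y := _ * S; have y0 : 0 <= y by rewrite mulr_ge0 ?invr_ge0 ?ler0n.
have -> : (y `^ 2^-1) ^+ 4 = y ^+ 2.
  by rewrite (exprM _ 2 2) -(powR_mulrn 2 (powR_ge0 _ _)) -powRrM mulVf ?powRr1.
rewrite rmorphXn rmorphM fmorphV rmorph_nat /= SE exprMn (card_H2 two0) natrX.
by rewrite -!exprVn -exprM.
Qed.

Definition H2_const (R : realType) (q : nat) : R :=
  1 + q%:R^-1 - q%:R^-1 ^+ 2.

Lemma H2_const_ge0 (R : realType) (q : nat) :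
  (0 < q)%N -> 0 <= H2_const R q.
Proof.
move=> q0; rewrite /H2_const -addrA addr_ge0 ?ler01 // subr_ge0.
by rewrite expr2 ler_piMr ?invr_ge0 ?ler0n // invf_le1 ?ltr0n // ler1n.
Qed.

(** Matches the two normalisations: q^-4 (1 + 1/q - 1/q^2) = q^-5 (q + 1 - 1/q). *)
Lemma H2_boundE (R : realType) (F : finFieldType)
    (f : points (H2 F) -> R[i]) :
  (2 : F) != 0 ->
  (H2_const R #|F| * norm_sigma 2 f ^+ 4)%:C =
  #|F|%:R ^- 5 * (sharp_const R[i] #|F| * sqmass (chart f) ^+ 2).
Proof.
move=> two0; rewrite rmorphM /= norm_sigma4 // /H2_const /sharp_const /=.
rewrite rmorphB rmorphD rmorphXn fmorphV rmorph_nat rmorph1 /=.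
have q0 := natr_card_neq0 R[i] F.
by field.
Qed.

Lemma norm_extension4 (R : realType) (F : finFieldType) (e : F -> R[i])
    (f : points (H2 F) -> R[i]) :
  (2 : F) != 0 -> nontrivial_additive_character e ->
  (norm_dx 4 (extension e f) ^+ 4)%:C = #|F|%:R ^- 5 * energy (chart f).
Proof. by move=> two0 he; rewrite norm_dx4 sum_extension4. Qed.

Lemma extension_le (R : realType) (F : finFieldType) (e : F -> R[i])
    (f : points (H2 F) -> R[i]) :
  (2 : F) != 0 -> nontrivial_additive_character e ->
  norm_dx 4 (extension e f) ^+ 4 <=
  H2_const R #|F| * norm_sigma 2 f ^+ 4.
Proof.
move=> two0 he; rewrite -lecR H2_boundE // norm_extension4 //.
(* The scaled energy is the fourth power of a norm, hence nonnegative, so the bound on its modulus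
   applies to it. *)
have E0 : 0 <= #|F|%:R ^- 5 * energy (chart f).
  by rewrite -(norm_extension4 _ two0 he) ler0c exprn_ge0 // powR_ge0.
rewrite -(ger0_norm E0) normrM normfV normrX normr_nat.
by rewrite ler_wpM2l ?energy_le.
Qed.

Lemma extension_eqP (R : realType) (F : finFieldType) (e : F -> R[i])
    (f : points (H2 F) -> R[i]) :
  (2 : F) != 0 -> nontrivial_additive_character e ->
  norm_dx 4 (extension e f) ^+ 4 = H2_const R #|F| * norm_sigma 2 f ^+ 4
  <-> energy (chart f) = sharp_const R[i] #|F| * sqmass (chart f) ^+ 2.
Proof.
move=> two0 he.
have q0 : #|F|%:R ^- 5 != 0 :> R[i].
  by rewrite invr_neq0 // expf_neq0 // natr_card_neq0.
split=> E.
  by apply: (mulfI q0); rewrite -H2_boundE // -E norm_extension4.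
by apply: complexI; rewrite H2_boundE // -E norm_extension4.
Qed.

Lemma extension_eq_root (R : realType) (F : finFieldType) (e : F -> R[i])
    (f : points (H2 F) -> R[i]) :
  norm_dx 4 (extension e f) ^+ 4 = H2_const R #|F| * norm_sigma 2 f ^+ 4
  <-> norm_dx 4 (extension e f) =
      H2_const R #|F| `^ 4^-1 * norm_sigma 2 f.
Proof.
have K0 : 0 <= H2_const R #|F|.
  by exact: H2_const_ge0 (card_field_gt0 F).
split=> [E|->]; last by rewrite exprMn (powR4K K0).
apply/eqP; rewrite -(eqrXn2 (n := 4)) ?mulr_ge0 ?powR_ge0 //.
by rewrite exprMn (powR4K K0) E.
Qed.

(** A constant satisfies the rectangle identity trivially; the constant 1 later serves as the test
    function for sharpness. *)
Lemma extension_cst (R : realType) (F : finFieldType) (e : F -> R[i])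
    (f : points (H2 F) -> R[i]) (z : R[i]) :
  (2 : F) != 0 -> nontrivial_additive_character e -> (forall xi, f xi = z) ->
  norm_dx 4 (extension e f) ^+ 4 = H2_const R #|F| * norm_sigma 2 f ^+ 4.
Proof.
move=> two0 he fz; apply/(extension_eqP _ two0 he).
by apply: (@extremal_energy _ _ _ `|z|) => *; rewrite /chart !fz.
Qed.

Lemma norm_sigma_gt0 (R : realType) (F : finFieldType)
    (f : points (H2 F) -> R[i]) :
  (2 : F) != 0 -> (exists xi, f xi != 0) -> 0 < norm_sigma 2 f.
Proof.
move=> two0 [xi fxi]; rewrite lt_neqAle powR_ge0 andbT eq_sym.
rewrite powR_eq0 negb_and mulf_neq0 //.
  by rewrite invr_neq0 // card_H2 // natrX expf_neq0 // natr_card_neq0.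
rewrite gt_eqF // (bigD1 xi) //= ltr_pwDl //.
  by rewrite powR_gt0 // -ltcR -normcC normr_gt0.
by apply: sumr_ge0 => x _; exact: powR_ge0.
Qed.

(** * The best constant and the maximizers *)

Lemma best_constantE (R : realType) (F : finFieldType) (e : F -> R[i]) :
  (2 : F) != 0 -> nontrivial_additive_character e ->
  best_constant e (H2 F) 2 4 = H2_const R #|F| `^ 4^-1.
Proof.
move=> two0 he; rewrite /best_constant; set S := mkset _.
have K0 : 0 <= H2_const R #|F|.
  by exact: H2_const_ge0 (card_field_gt0 F).
have SK : S (H2_const R #|F| `^ 4^-1).
  move=> f; rewrite -(ler_pXn2r (n := 4)) ?nnegrE ?mulr_ge0 ?powR_ge0 //.
  by rewrite exprMn (powR4K K0) // extension_le.
(* Testing on the constant function 1, where equality holds, bounds every admissible [A] from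
   below. *)
have lbK : lbound S (H2_const R #|F| `^ 4^-1).
  move=> A /(_ (fun _ => 1)).
  have /extension_eq_root -> :=
    extension_cst two0 he (fun _ => erefl (1 : R[i])).
  rewrite ler_pM2r // norm_sigma_gt0 //.
  by exists (hpoint 0); rewrite oner_eq0.
(* Since [S] has a member and a lower bound, [inf] is a genuine infimum and not the default 0. *)
apply/eqP; rewrite eq_le; apply/andP; split.
  by apply: ge_inf => //; exists (H2_const R #|F| `^ 4^-1).
by apply: lb_le_inf => //; exists (H2_const R #|F| `^ 4^-1).
Qed.

(** The character [chi] may differ from [e]: every character of [F] is a dilate of any nontrivial
    one, so the standard character can describe the maximizers for every [e]. *)
Lemma maximizerP (R : realType) (F : finFieldType) (e chi : F -> R[i])
    (f : points (H2 F) -> R[i]) :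
  (2 : F) != 0 -> nontrivial_additive_character e ->
  nontrivial_additive_character chi ->
  maximizer e 2 4 f <->
  exists (lambda : R[i]) (a b c : F), lambda != 0 /\
    forall w, chart f w = lambda * chi (a * w.1 + b * w.2 + c * (w.1 * w.2)).
Proof.
move=> two0 he hchi; have chi0 := nontrivial_char0 hchi.
have [chi1 chiD chin1] := hchi.
rewrite /maximizer best_constantE // -extension_eq_root extension_eqP //.
have [inv hK invK] := hpoint_bij two0.
split=> [[[xi fxi] E]|[l [a [b [c [l0 fE]]]]]].
  have [|r r0 [gr gD]] := energy_extremal E.
    by exists (inv xi); rewrite /chart invK.
  have gn0 w : chart f w != 0 by rewrite -normr_eq0 gr gt_eqF.
  (* Division by the value at 0 normalises the function to 1 there; that value becomes [lambda]. *)
  have [||w h u hu|a [b [c gE]]] := @orth_multiplicative _ _ chi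
      (fun w => chart f w / chart f 0) chi0 chiD chin1.
  - by rewrite divff.
  - by move=> w; rewrite mulf_neq0 ?invr_neq0.
  - by rewrite mulrACA gD // mulrACA.
  by exists (chart f 0), a, b, c; split=> // w; rewrite -gE mulrC divfK.
split.
  exists (hpoint 0).
  by rewrite -[f _]/(chart f 0) fE /= !mulr0 !addr0 chi0 mulr1.
apply: (@extremal_energy _ _ _ `|l|) => [w|w h u hu].
  by rewrite fE normrM [X in _ * X]normcC chi1 mulr1.
by rewrite !fE mulrACA [RHS]mulrACA (multiplicative_orth a b c w chiD hu).
Qed.

Theorem theorem1p4 (R : realType) (p n : nat) (F : finFieldType)
    (e : F -> R[i])
    (p_prime : prime p) (p_odd : odd p) (n_gt0 : (0 < n)%N)
    (cardF : #|F| = (p ^ n)%N)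
    (he : nontrivial_additive_character e) :
  let q : R := (p ^ n)%:R in
  let K : R := 1 + q^-1 - q^-1 ^+ 2 in
  [/\ best_constant e (H2 F) 2 4 = K `^ (4^-1),
      forall f : points (H2 F) -> R[i],
        norm_dx 4 (extension e f) ^+ 4 <= K * norm_sigma 2 f ^+ 4,
      forall K' : R,
        (forall f : points (H2 F) -> R[i],
           norm_dx 4 (extension e f) ^+ 4 <= K' * norm_sigma 2 f ^+ 4) ->
        K <= K',
      forall f : points (H2 F) -> R[i],
        (exists z : R[i], forall xi, f xi = z) ->
        norm_dx 4 (extension e f) ^+ 4 = K * norm_sigma 2 f ^+ 4
    & forall f : points (H2 F) -> R[i],
        maximizer e 2 4 f <->
        exists (lambda : R[i]) (a b c : F), lambda != 0 /\
          forall eta zeta : F,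
            H2_proj f (eta + zeta) (eta - zeta) =
            lambda * expi (2 * pi *
              (prime_rep p (trace p n (a * eta + b * zeta + c * (eta * zeta))))%:R
              / p%:R)].
Proof.
move=> q K; have two0 := odd_card_two_neq0 p_prime p_odd cardF.
have KE : K = H2_const R #|F| by rewrite /K /q -cardF.
rewrite KE; split.
- exact: best_constantE.
- by move=> f; exact: extension_le.
(* The constant function 1 attains equality and has positive norm, which can be cancelled. *)
- move=> K' /(_ (fun _ => 1)).
  rewrite (extension_cst two0 he (fun _ => erefl (1 : R[i]))) ler_pM2r //.
  rewrite exprn_gt0 // norm_sigma_gt0 //.
  by exists (hpoint 0); rewrite oner_eq0.
- by move=> f [z fz]; exact: extension_cst fz.
move=> f.
(* The exponential in the statement is [std_char], used as [chi] in [maximizerP]. *)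
have hchi : nontrivial_additive_character (std_char R p n : F -> R[i]).
  split; [|exact: std_charD|exact: std_char_neq1].
  by move=> x; apply: complexI; rewrite -normcC norm_expi.
rewrite (maximizerP f two0 he hchi).
split=> -[l [a [b [c [l0 fE]]]]]; exists l, a, b, c; split=> //.
  by move=> eta zeta; exact: (fE (eta, zeta)).
by move=> [eta zeta]; exact: fE.
Qed.
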